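(* Let $\mathcal{C}$ be a collection of pairs $((X,d),(a_n)_{n\in\mathbb{N}})$, where each $(X,d)$ is a metric space and $(a_n)_{n\in\mathbb{N}}$ is a sequence of elements of $X$. The following are equivalent: (1) For every real $\epsilon>0$ there is a $K\in\mathbb{N}$ such that for every pair $((X,d),(a_n)_{n\in\mathbb{N}})\in\mathcal{C}$ and every $n_1<n_2<\cdots<n_K$ in $\mathbb{N}$, there is a $k$ with $1\le k<K$ and $d(a_{n_k},a_{n_{k+1}})<\epsilon$. (2) Whenever $\mathcal{U}$ is a nonprincipal ultrafilter on $\mathbb{N}$ and, for each $i\in\mathbb{N}$, $((X_i,d_i),(a^i_n)_{n\in\mathbb{N}})\in\mathcal{C}$, the extended sequence $(a_{\bar n})_{\bar n\in\mathbb{N}^*}$ in the metric ultraproduct $(X_{\mathcal{U}},d_{\mathcal{U}})=\prod_{\mathcal{U}}(X_i,d_i)$ converges in every cut $I\subseteq\mathbb{N}^*$.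
   Context: Let $\mathcal{U}$ be a nonprincipal ultrafilter on $\mathbb{N}$. Ultralimit: for reals $(r_i)_{i\in\mathbb{N}}$ such that $\{i : |r_i|\le B\}\in\mathcal{U}$ for some $B$, $\lim_{\mathcal{U}} r_i$ is the unique $r\in\mathbb{R}$ such that $\{i : |r_i-r|<\epsilon\}\in\mathcal{U}$ for every $\epsilon>0$. Metric ultraproduct: for metric spaces $(X_i,d_i)$, $i\in\mathbb{N}$, let $X_{\mathcal{U}}$ be the set of all sequences $\langle x_i\rangle_{i\in\mathbb{N}}$ with $x_i\in X_i$, modulo the equivalence relation $\langle x_i\rangle\sim\langle y_i\rangle$ iff $\lim_{\mathcal{U}}d_i(x_i,y_i)=0$. Set $d_{\mathcal{U}}([\langle x_i\rangle],[\langle y_i\rangle])=\lim_{\mathcal{U}}d_i(x_i,y_i)$ if this ultralimit exists, and $\infty$ otherwise (so $d_{\mathcal{U}}$ may take the value $\infty$). Nonstandard natural numbers: $\mathbb{N}^*$ (relative to $\mathcal{U}$) is the set of sequences $\langle n_i\rangle_{i\in\mathbb{N}}$ of natural numbers modulo the relation $\{i : n_i=m_i\}\in\mathcal{U}$, with order and arithmetic defined coordinatewise modulo $\mathcal{U}$. Extended sequence: given sequences $(a^i_n)_{n\in\mathbb{N}}$ in $X_i$, for $\bar n=[\langle n_i\rangle]\in\mathbb{N}^*$ put $a_{\bar n}=[\langle a^i_{n_i}\rangle]\in X_{\mathcal{U}}$ (this is well defined). Cut: a cut in $\mathbb{N}^*$ is a nonempty initial segment $I\subseteq\mathbb{N}^*$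 such that $\bar n\in I$ implies $\bar n+1\in I$. Convergence in a cut: $(a_{\bar n})_{\bar n\in\mathbb{N}^*}$ converges in $I$ if for every real $\epsilon>0$ there is an $\bar n\in I$ such that for all $\bar m\in I$ with $\bar m>\bar n$, $d_{\mathcal{U}}(a_{\bar n},a_{\bar m})<\epsilon$. *)

(* Defs.v *)
From HB Require Import structures.
From mathcomp Require Export all_boot all_order all_algebra.
From mathcomp Require Export generic_quotient.
From mathcomp Require Export all_classical all_reals all_analysis.
From mathcomp Require Import lra.

Set Implicit Arguments.
Unset Strict Implicit.
Unset Printing Implicit Defensive.

Import Order.TTheory GRing.Theory Num.Theory numFieldNormedType.Exports.

Local Open Scope classical_set_scope.
Local Open Scope ring_scope.
Local Open Scope quotient_scope.

Definition nonprincipal (T : Type) (U : set_system T) : Prop :=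
  forall x : T, U <> principal_filter x.

(* The ultralimit of r along U is [lim (r @ U)] and exists when [cvg (r @ U)];
   the next two lemmas match this with the epsilon characterization and with
   the boundedness condition for existence. *)
Lemma ultralimP (R : realType) (U : set_system nat) (UU : UltraFilter U)
    (r : nat -> R) (l : R) :
  r @ U --> l <-> forall e : R, 0 < e -> U [set i | `|r i - l| < e].
Proof.
rewrite cvgrPdist_lt; split=> H e e0; have := H e e0; apply: filterS => i /=;
by rewrite distrC.
Qed.

Lemma ultralim_bounded (R : realType) (U : set_system nat) (UU : UltraFilter U)
    (r : nat -> R) :
  cvg (r @ U) <-> exists B : R, U [set i | `|r i| <= B].
Proof.
split=> [/cvg_ex[l /ultralimP/(_ 1 ltr01) rl]|[B rB]].
  exists (`|l| + 1); apply: filterS rl => i /= il.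
  by rewrite -(subrK l (r i)) (le_trans (ler_normD _ _))// addrC lerD2l ltW.
have rU : UltraFilter (r @ U).
  split; first exact: fmap_proper_filter.
  move=> G GG sub; rewrite eqEsubset; split=> // A GA.
  have [//|nA] := in_ultra_setVsetC (r @^-1` A) UU.
  have /filterI/(_ GA)/filter_ex[x []] // : G (~` A) by exact: sub.
have := @segment_compact R (- B) B; rewrite compact_ultra => /(_ _ rU).
case; last by move=> l [_ rl]; apply/cvg_ex; exists l.
suff: U (r @^-1` `[- B, B]) by [].
by apply: filterS rB => i; rewrite /= in_itv/= ler_norml.
Qed.

Definition nstar_eqv (U : set_system nat) : rel (nat -> nat) :=
  fun m n => `[< \forall i \near U, m i = n i >].

Lemma nstar_eqv_refl (U : set_system nat) (UU : UltraFilter U) :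
  reflexive (nstar_eqv U).
Proof. by move=> m; apply/asboolP; near=> i. Unshelve. all: by end_near. Qed.

Lemma nstar_eqv_sym (U : set_system nat) (UU : UltraFilter U) :
  symmetric (nstar_eqv U).
Proof.
by move=> m n; apply: asbool_equiv_eq; split; apply: filterS => i ->.
Qed.

Lemma nstar_eqv_trans (U : set_system nat) (UU : UltraFilter U) :
  transitive (nstar_eqv U).
Proof.
move=> n m p /asboolP mn /asboolP np; apply/asboolP.
by apply: filterS2 mn np => i -> ->.
Qed.

Canonical nstar_equiv (U : set_system nat) (UU : UltraFilter U) :=
  EquivRel (nstar_eqv U) (nstar_eqv_refl UU) (nstar_eqv_sym UU)
    (@nstar_eqv_trans U UU).

Definition nstar (U : set_system nat) {UU : UltraFilter U} : Type :=
  {eq_quot nstar_equiv UU}.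
HB.instance Definition _ (U : set_system nat) (UU : UltraFilter U) :=
  Choice.on (@nstar U UU).
HB.instance Definition _ (U : set_system nat) (UU : UltraFilter U) :=
  Quotient.on (@nstar U UU).
Arguments nstar U {UU}.

Lemma nstar_piP (U : set_system nat) (UU : UltraFilter U) (m n : nat -> nat) :
  \pi_(nstar U) m = \pi_(nstar U) n <-> \forall i \near U, m i = n i.
Proof. by split=> [/eqmodP/asboolP|mn]//; apply/eqmodP/asboolP. Qed.

(* Operations on the quotients go through [repr]; the [_pi] lemmas show that
   they do not depend on the representatives. *)
Definition nstar_add (U : set_system nat) (UU : UltraFilter U)
    (m n : nstar U) : nstar U :=
  \pi_(nstar U) (fun i => (repr m i + repr n i)%N).

Definition nstar_std (U : set_system nat) (UU : UltraFilter U) (k : nat) :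
  nstar U := \pi_(nstar U) (fun=> k).

Definition nstar_le (U : set_system nat) (UU : UltraFilter U)
    (m n : nstar U) : Prop := \forall i \near U, (repr m i <= repr n i)%N.

Definition nstar_lt (U : set_system nat) (UU : UltraFilter U)
    (m n : nstar U) : Prop := \forall i \near U, (repr m i < repr n i)%N.

Lemma nstar_repr (U : set_system nat) (UU : UltraFilter U) (m : nat -> nat) :
  \forall i \near U, repr (\pi_(nstar U) m) i = m i.
Proof. by apply/nstar_piP; rewrite reprK. Qed.

Lemma nstar_add_pi (U : set_system nat) (UU : UltraFilter U)
    (m n : nat -> nat) :
  nstar_add (\pi_(nstar U) m) (\pi_(nstar U) n) =
  \pi_(nstar U) (fun i => (m i + n i)%N).
Proof.
apply/nstar_piP; apply: filterS2 (nstar_repr UU m) (nstar_repr UU n).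
by move=> i -> ->.
Qed.

Lemma nstar_le_pi (U : set_system nat) (UU : UltraFilter U) (m n : nat -> nat) :
  nstar_le (\pi_(nstar U) m) (\pi_(nstar U) n) <->
  \forall i \near U, (m i <= n i)%N.
Proof.
by split; apply: filterS3 (nstar_repr UU m) (nstar_repr UU n) => i -> ->.
Qed.

Lemma nstar_lt_pi (U : set_system nat) (UU : UltraFilter U) (m n : nat -> nat) :
  nstar_lt (\pi_(nstar U) m) (\pi_(nstar U) n) <->
  \forall i \near U, (m i < n i)%N.
Proof.
by split; apply: filterS3 (nstar_repr UU m) (nstar_repr UU n) => i -> ->.
Qed.

Definition is_cut (U : set_system nat) (UU : UltraFilter U)
    (I : set (nstar U)) : Prop :=
  [/\ I !=set0,
      forall m n : nstar U, nstar_le m n -> I n -> I m &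
      forall n : nstar U, I n -> I (nstar_add n (nstar_std UU 1))].

Definition ultraprod_eqv (R : realType) (X : nat -> metricType R)
    (U : set_system nat) : rel (forall i, X i) :=
  fun x y => `[< (fun i => mdist (x i) (y i)) @ U --> (0 : R) >].
Arguments ultraprod_eqv {R} X U.

Lemma ultraprod_eqv_refl (R : realType) (X : nat -> metricType R)
    (U : set_system nat) (UU : UltraFilter U) : reflexive (ultraprod_eqv X U).
Proof.
move=> x; apply/asboolP; under eq_fun do rewrite mdistxx; exact: cvg_cst.
Qed.

Lemma ultraprod_eqv_sym (R : realType) (X : nat -> metricType R)
    (U : set_system nat) (UU : UltraFilter U) : symmetric (ultraprod_eqv X U).
Proof.
by move=> x y; rewrite /ultraprod_eqv; under eq_fun do rewrite metric_sym.
Qed.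

Lemma ultraprod_eqv_trans (R : realType) (X : nat -> metricType R)
    (U : set_system nat) (UU : UltraFilter U) :
  transitive (ultraprod_eqv X U).
Proof.
move=> y x z /asboolP xy /asboolP yz; apply/asboolP.
apply: (@squeeze_cvgr _ _ _ _ (cst 0)
  (fun i => mdist (x i) (y i) + mdist (y i) (z i))).
- by apply: nearW => i; rewrite mdist_ge0 metric_triangle.
- exact: cvg_cst.
- by rewrite -[0]addr0; apply: cvgD.
Qed.

Canonical ultraprod_equiv (R : realType) (X : nat -> metricType R)
    (U : set_system nat) (UU : UltraFilter U) :=
  EquivRel (ultraprod_eqv X U) (@ultraprod_eqv_refl R X U UU)
    (@ultraprod_eqv_sym R X U UU) (@ultraprod_eqv_trans R X U UU).

Definition ultraprod (R : realType) (X : nat -> metricType R)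
    (U : set_system nat) {UU : UltraFilter U} : Type :=
  {eq_quot @ultraprod_equiv R X U UU}.
HB.instance Definition _ (R : realType) (X : nat -> metricType R)
    (U : set_system nat) (UU : UltraFilter U) := Choice.on (@ultraprod R X U UU).
HB.instance Definition _ (R : realType) (X : nat -> metricType R)
    (U : set_system nat) (UU : UltraFilter U) :=
  Quotient.on (@ultraprod R X U UU).
Arguments ultraprod {R} X U {UU}.

Lemma ultraprod_piP (R : realType) (X : nat -> metricType R)
    (U : set_system nat) (UU : UltraFilter U) (x y : forall i, X i) :
  \pi_(ultraprod X U) x = \pi_(ultraprod X U) y <->
  (fun i => mdist (x i) (y i)) @ U --> (0 : R).
Proof. by split=> [/eqmodP/asboolP|xy]//; apply/eqmodP/asboolP. Qed.

Definition seqdist (R : realType) (X : nat -> metricType R)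
    (U : set_system nat) (x y : forall i, X i) : \bar R :=
  let r : nat -> R := fun i => mdist (x i) (y i) in
  if `[< cvg (r @ U) >] then (lim (r @ U))%:E else +oo%E.

Definition ultradist (R : realType) (X : nat -> metricType R)
    (U : set_system nat) (UU : UltraFilter U) (p q : ultraprod X U) : \bar R :=
  seqdist U (repr p) (repr q).

Lemma ultradist_pi (R : realType) (X : nat -> metricType R)
    (U : set_system nat) (UU : UltraFilter U) (x y : forall i, X i) :
  ultradist (\pi_(ultraprod X U) x) (\pi_(ultraprod X U) y) = seqdist U x y.
Proof.
have key (u v u' v' : forall i, X i) (l : R) :
    (fun i => mdist (u i) (u' i)) @ U --> (0 : R) ->
    (fun i => mdist (v i) (v' i)) @ U --> (0 : R) ->
    (fun i => mdist (u i) (v i)) @ U --> l ->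
    (fun i => mdist (u' i) (v' i)) @ U --> l.
  move=> uu' vv' uv; set s := fun i => mdist (u i) (u' i) + mdist (v i) (v' i).
  have s0 : s @ U --> (0 : R) by rewrite -[0]addr0; apply: cvgD.
  apply: (@squeeze_cvgr _ _ _ _ (fun i => mdist (u i) (v i) - s i)
    (fun i => mdist (u i) (v i) + s i)).
  - apply: nearW => i; rewrite /s.
    have := metric_triangle (u i) (u' i) (v i).
    have := metric_triangle (u' i) (v' i) (v i).
    have := metric_triangle (u' i) (u i) (v' i).
    have := metric_triangle (u i) (v i) (v' i).
    rewrite (metric_sym (v' i) (v i)) (metric_sym (u' i) (u i)) => *.
    by rewrite lerBlDr; apply/andP; split; lra.
  - by rewrite -[l]subr0; apply: cvgB.
  - by rewrite -[l]addr0; apply: cvgD.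
have rp (u : forall i, X i) :
    (fun i => mdist (repr (\pi_(ultraprod X U) u) i) (u i)) @ U --> (0 : R).
  by apply/ultraprod_piP; rewrite reprK.
have rp' (u : forall i, X i) :
    (fun i => mdist (u i) (repr (\pi_(ultraprod X U) u) i)) @ U --> (0 : R).
  by apply/ultraprod_piP; rewrite reprK.
rewrite /ultradist /seqdist.
have [/cvg_ex[l xy]|nxy] := pselect (cvg ((fun i => mdist (x i) (y i)) @ U)).
  have xy' := key _ _ _ _ _ (rp' x) (rp' y) xy.
  rewrite !asboolT; [|by apply/cvg_ex; exists l..].
  by rewrite (cvg_lim _ xy)// (cvg_lim _ xy').
rewrite !asboolF// => /cvg_ex[l xy]; apply: nxy; apply/cvg_ex; exists l.
exact: key (rp x) (rp y) xy.
Qed.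

Definition extseq (R : realType) (X : nat -> metricType R)
    (U : set_system nat) (UU : UltraFilter U) (a : forall i, nat -> X i)
    (n : nstar U) : ultraprod X U :=
  \pi_(ultraprod X U) (fun i => a i (repr n i)).

Lemma extseq_pi (R : realType) (X : nat -> metricType R)
    (U : set_system nat) (UU : UltraFilter U) (a : forall i, nat -> X i)
    (n : nat -> nat) :
  extseq a (\pi_(nstar U) n) = \pi_(ultraprod X U) (fun i => a i (n i)).
Proof.
apply/ultraprod_piP/ultralimP => e e0; apply: filterS (nstar_repr UU n).
by move=> i /= ->; rewrite mdistxx subr0 normr0.
Qed.

Definition converges_in (R : realType) (X : nat -> metricType R)
    (U : set_system nat) (UU : UltraFilter U) (b : nstar U -> ultraprod X U)
    (I : set (nstar U)) : Prop :=
  forall e : R, 0 < e -> exists2 n : nstar U, I n &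
    forall m : nstar U, I m -> nstar_lt n m ->
      (ultradist (b n) (b m) < e%:E)%E.

(* Main.v *)
(* Failure of convergence in a cut I yields, for each K, a chain n_1 < ... < n_K
   in I with all consecutive distances at least e, and such a chain descends to
   almost every coordinate. Conversely, if chains of every length K with gaps at
   least e exist in members of C, take the ultraproduct over K; in the cut
   generated by the points n_j = <n_j^K>_K with j standard, no point is followed
   only by e/2-close terms, since consecutive a_(n_j) stay e apart. *)

Require Import Defs.
From mathcomp Require Import all_boot all_order all_algebra.
From mathcomp Require Import generic_quotient.
From mathcomp Require Import all_classical all_reals all_analysis.

Set Implicit Arguments.
Unset Strict Implicit.
Unset Printing Implicit Defensive.

Import Order.TTheory GRing.Theory Num.Theory numFieldNormedType.Exports.

Local Open Scope classical_set_scope.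
Local Open Scope ring_scope.

Lemma ultradist_lt (R : realType) (X : nat -> metricType R)
    (U : set_system nat) (UU : UltraFilter U) (x y : forall i, X i) (e : R) :
  (ultradist (\pi_(ultraprod X U)%qT x) (\pi_(ultraprod X U)%qT y) < e%:E)%E ->
  \forall i \near U, mdist (x i) (y i) < e.
Proof.
rewrite ultradist_pi /seqdist; case: asboolP => // cxy; rewrite lte_fin => le.
(* The positive margin between the limit and [e] is the tolerance that keeps almost all coordinates
   below [e]. *)
have /cvgrPdist_lt/(_ (e - lim ((fun i => mdist (x i) (y i)) @ U))) := cxy.
rewrite subr_gt0 => /(_ le); apply: filterS => i /=.
by rewrite ltr_norml => /andP[+ _]; rewrite ltrNl opprB ltrBlDr subrK.
Qed.

(** Otherwise, by the ultrafilter dichotomy, the coordinate distances are at most [e] almost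
    everywhere, so their ultralimit exists and is at most [e]. This also covers the distance
    [+oo]. *)
Lemma ultradist_gt (R : realType) (X : nat -> metricType R)
    (U : set_system nat) (UU : UltraFilter U) (x y : forall i, X i) (e : R) :
  (e%:E < ultradist (\pi_(ultraprod X U)%qT x) (\pi_(ultraprod X U)%qT y))%E ->
  \forall i \near U, e < mdist (x i) (y i).
Proof.
have [//|Un] := in_ultra_setVsetC [set i | e < mdist (x i) (y i)] UU.
have dist_le : \forall i \near U, mdist (x i) (y i) <= e.
  by apply: filterS Un => i /= /negP; rewrite -leNgt.
have cxy : cvg ((fun i => mdist (x i) (y i)) @ U).
  apply/ultralim_bounded; exists e; apply: filterS dist_le => i.
  by rewrite /= ger0_norm // mdist_ge0.
rewrite ultradist_pi /seqdist asboolT // lte_fin ltNge => /negP[].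
exact: limr_le.
Qed.

(** Containing [\oo] excludes principal filters and makes whatever holds for all large [i] hold
    along [U]. *)
Lemma nonprincipal_ultrafilter_nat :
  exists2 U : set_system nat, UltraFilter U & nonprincipal U /\ \oo `<=` U.
Proof.
have [U [UU oU]] := ultraFilterLemma (F := \oo) eventually_filter.
exists U => //; split=> // x Ux.
have : U [set n | (x < n)%N] by apply: oU; exists x.+1.
by rewrite Ux /principal_filter /= => /(_ x erefl); rewrite ltnn.
Qed.

Lemma near_forall_ltn (T : Type) (F : set_system T) {FF : Filter F}
    (P : nat -> T -> Prop) (K : nat) :
  (forall j, \forall i \near F, P j i) ->
  \forall i \near F, forall j, (j < K)%N -> P j i.
Proof.
move=> FP; elim: K => [|K IH]; first exact: nearW.
apply: filterS2 IH (FP K) => i PK PKi j.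
by rewrite ltnS leq_eqVlt => /predU1P[->|/PK].
Qed.

Lemma uniform_gap_converges (R : realType)
    (C : forall X : metricType R, (nat -> X) -> Prop)
    (U : set_system nat) (UU : UltraFilter U)
    (X : nat -> metricType R) (a : forall i : nat, nat -> X i)
    (I : set (nstar U)) :
  (forall e : R, 0 < e ->
     exists K : nat, forall (X : metricType R) (a : nat -> X), C X a ->
       forall n : nat -> nat,
         (forall j : nat, (1 <= j < K)%N -> (n j < n j.+1)%N) ->
         exists k : nat, (1 <= k < K)%N /\ mdist (a (n k)) (a (n k.+1)) < e) ->
  (forall i : nat, C (X i) (a i)) -> I !=set0 -> converges_in (extseq a) I.
Proof.
move=> gap Ca [p0 Ip0] e e0; apply: contrapT => nconv.
(* If [p] does not witness convergence, some later point of [I] is at least [e] away. Working in the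
   subtype keeps the iterates in [I]. *)
have next (p : {p | I p}) : exists q : {p | I p},
    nstar_lt (sval p) (sval q) /\
    (e%:E <= ultradist (extseq a (sval p)) (extseq a (sval q)))%E.
  apply: contrapT => nq; apply: nconv; exists (sval p); first exact: svalP.
  move=> m Im pm; rewrite ltNge; apply/negP => em.
  by apply: nq; exists (exist _ m Im).
have {next} [f fP] := choice next.
pose p j : nstar U := sval (iter j f (exist _ p0 Ip0)).
(* An ultralimit of at least [e] allows coordinate distances slightly below [e]; the smaller bound
   [e / 2] is strict and descends to coordinates. *)
have e20 : 0 < e / 2 by rewrite divr_gt0.
have [K KP] := gap _ e20.
have chain j : \forall i \near U, (repr (p j) i < repr (p j.+1) i)%N /\
    e / 2 < mdist (a i (repr (p j) i)) (a i (repr (p j.+1) i)).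
  have [lt_p dist_p] := fP (iter j f (exist _ p0 Ip0)).
  have e2e : ((e / 2)%:E < e%:E)%E.
    by rewrite lte_fin ltr_pdivrMr // ltr_pMr // ltr1n.
  by apply: filterS2 lt_p (ultradist_gt (lt_le_trans e2e dist_p)).
have [i iP] := filter_ex (near_forall_ltn K chain).
have [j /andP[_ jK]|k [/andP[_ kK]]] := KP _ _ (Ca i) (fun j => repr (p j) i).
  by have [] := iP j jK.
by have [_ /ltW] := iP k kK; rewrite leNgt => /negP.
Qed.

(** For closure under successor, [m <= n j < n j.+1] in a coordinate gives [m + 1 <= n j.+1]
    there. *)
Lemma standard_cut (U : set_system nat) (UU : UltraFilter U)
    (n : nat -> nstar U) :
  (forall j, nstar_lt (n j) (n j.+1)) ->
  is_cut [set m | exists j, nstar_le m (n j)].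
Proof.
move=> n_lt; split.
- by exists (n 0%N), 0%N; apply: nearW.
- move=> m p mp [j pj]; exists j.
  by apply: filterS2 mp pj => i; exact: leq_trans.
- move=> m [j mj]; exists j.+1; rewrite -[m in nstar_add m _]reprK.
  rewrite /nstar_std nstar_add_pi -[n j.+1]reprK; apply/nstar_le_pi.
  by apply: filterS2 mj (n_lt j) => i; rewrite addn1; exact: leq_ltn_trans.
Qed.

Lemma converges_uniform_gap (R : realType)
    (C : forall X : metricType R, (nat -> X) -> Prop) (e : R) :
  (forall (U : set_system nat) (UU : UltraFilter U), nonprincipal U ->
     forall (X : nat -> metricType R) (a : forall i : nat, nat -> X i),
       (forall i : nat, C (X i) (a i)) ->
       forall I : set (nstar U), is_cut I -> converges_in (extseq a) I) ->
  0 < e ->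
  exists K : nat, forall (X : metricType R) (a : nat -> X), C X a ->
    forall n : nat -> nat,
      (forall j : nat, (1 <= j < K)%N -> (n j < n j.+1)%N) ->
      exists k : nat, (1 <= k < K)%N /\ mdist (a (n k)) (a (n k.+1)) < e.
Proof.
move=> conv e0; apply: contrapT => ngap.
(* Space, sequence and indices are bundled so that a single choice selects a counterexample for
   every [K]. *)
have counterex K : exists t : {X : metricType R & (nat -> X)} * (nat -> nat),
    C (projT1 t.1) (projT2 t.1) /\
    forall j, (1 <= j < K)%N -> (t.2 j < t.2 j.+1)%N /\
      e <= mdist (projT2 t.1 (t.2 j)) (projT2 t.1 (t.2 j.+1)).
  apply: contrapT => nK; apply: ngap; exists K => X a CXa n n_lt.
  apply: contrapT => nk; apply: nK; exists (existT _ X a, n); split=> // j jK.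
  split; first exact: n_lt.
  by rewrite leNgt; apply/negP => lt_e; apply: nk; exists j.
have {counterex} [t tP] := choice counterex.
have [U UU [npU ooU]] := nonprincipal_ultrafilter_nat.
pose X i := projT1 (t i).1; pose a i : nat -> X i := projT2 (t i).1.
(* Chains are indexed from 1, hence the shift. The gap following index [j.+1] is guaranteed in
   coordinate [i] once [i >= j.+2]. *)
have chain j : \forall i \near U, ((t i).2 j.+1 < (t i).2 j.+2)%N /\
    e <= mdist (a i ((t i).2 j.+1)) (a i ((t i).2 j.+2)).
  by apply: ooU; exists j.+2 => // i /= ji; apply: (tP i).2.
pose n j := \pi_(@nstar U UU)%qT (fun i => (t i).2 j.+1).
have n_lt j : nstar_lt (n j) (n j.+1).
  by apply/nstar_lt_pi; apply: filterS (chain j) => i [].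
have e20 : 0 < e / 2 by rewrite divr_gt0.
have [p [j pj] pP] := conv U UU npU X a (fun i => (tP i).1) _
  (standard_cut n_lt) _ e20.
have close k : nstar_lt p (n k) ->
    \forall i \near U, mdist (a i (repr p i)) (a i ((t i).2 k.+1)) < e / 2.
  move=> pk; have Ink : exists j, nstar_le (n k) (n j).
    by exists k; apply: nearW.
  by have := pP _ Ink pk; rewrite extseq_pi; exact: ultradist_lt.
(* Since [p] may equal [n j], it is compared with the next two points, both strictly above it. *)
have pj1 : nstar_lt p (n j.+1).
  by apply: filterS2 pj (n_lt j) => i; exact: leq_ltn_trans.
have pj2 : nstar_lt p (n j.+2).
  by apply: filterS2 pj1 (n_lt j.+1) => i; exact: ltn_trans.
(* In a common coordinate both points lie within [e / 2] of the term at [p], contradicting their gap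
   of at least [e]. *)
have [i [[c1 c2] [_ far]]] := filter_ex
  (filterI (filterI (close _ pj1) (close _ pj2)) (chain j.+1)).
move: far; rewrite leNgt => /negP; apply.
apply: le_lt_trans (metric_triangle _ (a i (repr p i)) _) _.
by rewrite metric_sym [ltRHS]splitr ltrD.
Qed.

Theorem theorem1p1 (R : realType)
    (C : forall X : metricType R, (nat -> X) -> Prop) :
  (forall e : R, 0 < e ->
     exists K : nat, forall (X : metricType R) (a : nat -> X), C X a ->
       forall n : nat -> nat,
         (forall j : nat, (1 <= j < K)%N -> (n j < n j.+1)%N) ->
         exists k : nat, (1 <= k < K)%N /\ mdist (a (n k)) (a (n k.+1)) < e)
  <->
  (forall (U : set_system nat) (UU : UltraFilter U), nonprincipal U ->
     forall (X : nat -> metricType R) (a : forall i : nat, nat -> X i),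
       (forall i : nat, C (X i) (a i)) ->
       forall I : set (nstar U), is_cut I -> converges_in (extseq a) I).
Proof.
split=> [gap U UU _ X a Ca I [I0 _ _]|conv e].
  exact: uniform_gap_converges gap Ca I0.
exact: converges_uniform_gap.
Qed.
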